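(* Let $G$ be a graph of order $n$ with at least $n$ edges and with no isolated vertices. If $G$ is $C_4$-free and $\Delta(G)\le 3$, then $\mathcal{E}(G)>n$.
   Context: All graphs are finite, simple and undirected, with at least one vertex. The order of a graph is its number of vertices, and $\Delta(G)$ is the maximum degree of $G$. $G$ is $C_4$-free if it contains no cycle of length $4$ as a (not necessarily induced) subgraph. If $G$ has order $n$ and $\mu_1\ge\cdots\ge\mu_n$ are the eigenvalues of the adjacency matrix of $G$ (with multiplicity), the energy of $G$ is $\mathcal{E}(G)=|\mu_1|+\cdots+|\mu_n|$. *)

(* Defs.v *)
From HB Require Import structures.
From mathcomp Require Import all_boot all_order all_algebra all_field.
Set Implicit Arguments.
Unset Strict Implicit.
Unset Printing Implicit Defensive.
Import Order.TTheory GRing.Theory Num.Theory.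
Local Open Scope ring_scope.

Record sgraph := SGraph {
  vertex :> finType;
  adj : rel vertex;
  adj_sym : symmetric adj;
  adj_irrefl : irreflexive adj }.

Arguments adj {s} : rename.

Definition edges (G : sgraph) : {set {set G}} :=
  [set E : {set G} | [exists x, exists y, adj x y && (E == [set x; y])]].

Definition degree (G : sgraph) (x : G) : nat := #|[set y | adj x y]|.

Definition max_degree (G : sgraph) : nat := (\max_(x : G) degree x)%N.

Definition isolated (G : sgraph) (x : G) : bool := degree x == 0%N.

Definition C4_free (G : sgraph) : Prop :=
  forall c : 4.-tuple G, ~ ucycle adj c.

(* Entries are taken in algC so that the characteristic polynomial splits;
   the vertices are ordered by their library enumeration. *)
Definition adj_mx (G : sgraph) : 'M[algC]_#|G| :=
  \matrix_(i, j) (adj (enum_val i) (enum_val j))%:R.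

(* The list of eigenvalues, repeated according to algebraic multiplicity,
   in no particular order: see [char_poly_eigenvalues]. *)
Definition eigenvalues (n : nat) (A : 'M[algC]_n) : seq algC :=
  sval (closed_field_poly_normal (char_poly A)).

Lemma char_poly_eigenvalues (n : nat) (A : 'M[algC]_n) :
  char_poly A = \prod_(mu <- eigenvalues A) ('X - mu%:P).
Proof.
rewrite /eigenvalues; case: closed_field_poly_normal => r /= {1}->.
by rewrite (monicP (char_poly_monic A)) scale1r.
Qed.

Lemma size_eigenvalues (n : nat) (A : 'M[algC]_n) : size (eigenvalues A) = n.
Proof.
by apply: succn_inj; rewrite -(size_char_poly A) char_poly_eigenvalues
  size_prod_XsubC.
Qed.

(* The energy is a real number; on algC the order x < y entails that
   y - x is real. *)
Definition energy (G : sgraph) : algC :=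
  \sum_(mu <- eigenvalues (adj_mx G)) `|mu|.

(* Main.v *)
Require Import Defs.
From HB Require Import structures.
From mathcomp Require Import all_boot all_order all_algebra all_field.
From mathcomp Require Import zify ring.
Set Implicit Arguments.
Unset Strict Implicit.
Unset Printing Implicit Defensive.
Import Order.TTheory GRing.Theory Num.Theory.
Local Open Scope ring_scope.

(** A quartic minorant of the absolute value reduces the energy to closed
walks of lengths 2 and 4.  For real x,
<<
  16 |x| - (12 x^2 - x^4) = |x| (|x| + 4) (|x| - 2)^2 >= 0,
>>
with equality exactly when x^4 = 4 x^2.  Summed over the spectrum of the
adjacency matrix A, which is unitarily diagonalizable, this gives
16 E(G) >= 12 tr A^2 - tr A^4, with equality exactly when A^4 = 4 A^2
([norm_eigenvalues_ge]).

Let d be the degree function, D the sum of the degrees and D2 the sum of their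
squares.  Then tr A^2 = D.  In a C4-free graph two distinct vertices have at
most one common neighbour, so that A^2 has 0/1 entries off the diagonal, and
[sum_codegree_sqr] computes the diagonal of A^4; its trace is 2 D2 - D.
Degrees lie between 1 and 3, so (d - 1)(d - 3) <= 0 and D2 <= 4 D - 3 n.
Altogether 16 E(G) >= 13 D - 2 D2 >= 5 D + 6 n, which is at least 16 n because
D is twice the number of edges.

If E(G) = n, all these estimates are tight: D = 2 n and A^4 = 4 A^2.  On the
diagonal the matrix equation says that the degrees of the neighbours of a
vertex x sum to d(x) (5 - d(x)).  As this sum is at most 3 d(x), every degree is
at least 2, hence equal to 2 because D = 2 n; but then the neighbours of a
vertex would have degrees summing to 4 and to 6 ([adj_mx_pow4_neq]). *)

(** * Degrees and common neighbours *)

Section Walks.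
Variable G : sgraph.
Implicit Types x y z : G.

Definition codegree x y : nat := #|[set z | adj x z && adj z y]|.

Lemma degree_sum x : degree x = (\sum_y adj x y)%N.
Proof.
rewrite /degree -sum1dep_card big_mkcond.
by apply: eq_bigr => y _; case: adj.
Qed.

Lemma codegree_sum x y : codegree x y = (\sum_z adj x z * adj z y)%N.
Proof.
rewrite /codegree -sum1dep_card big_mkcond.
by apply: eq_bigr => z _; case: adj; case: adj.
Qed.

Lemma codegreexx x : codegree x x = degree x.
Proof.
rewrite codegree_sum degree_sum; apply: eq_bigr => z _.
by rewrite [adj z x]adj_sym mulnn; case: adj.
Qed.

(** Both sides count the walks of length 2 from [x]. *)
Lemma sum_codegree x : (\sum_y codegree x y = \sum_(z | adj x z) degree z)%N.
Proof.
under eq_bigr do rewrite codegree_sum.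
rewrite exchange_big [RHS]big_mkcond; apply: eq_bigr => z _ /=.
by rewrite -big_distrr /= -degree_sum; case: adj; rewrite ?mul1n.
Qed.

(** Each vertex is a neighbour as many times as its degree. *)
Lemma sum_degree_neighbours :
  (\sum_(x : G) \sum_(y | adj x y) degree y = \sum_(x : G) degree x ^ 2)%N.
Proof.
under eq_bigr do rewrite big_mkcond /=.
rewrite exchange_big; apply: eq_bigr => y _ /=.
rewrite -big_mkcond /= sum_nat_const expnS expn1; congr (_ * _)%N.
by apply: eq_card => x; rewrite !inE adj_sym.
Qed.

(** Double counting of the pairs of an edge and one of its endpoints; [y]
and [[set x; y]] determine each other among the edges at [x]. *)
Lemma handshake : (2 * #|edges G| = \sum_(x : G) degree x)%N.
Proof.
have card_edge (E : {set G}) : E \in edges G -> #|E| = 2.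
  rewrite inE => /existsP[x /existsP[y /andP[xy /eqP->]]].
  by rewrite cards2; case: eqP xy => // ->; rewrite adj_irrefl.
rewrite mulnC -sum_nat_const -(eq_bigr _ card_edge).
under eq_bigr do rewrite -sum1_card big_mkcond /=.
rewrite exchange_big; apply: eq_bigr => x _ /=.
rewrite -big_mkcondr sum1dep_card /degree /=.
rewrite -(card_imset [set y | adj x y] (f := fun y => [set x; y])); last first.
  move=> y z /setP eq_yz; move: (eq_yz y) (eq_yz z); rewrite !inE !eqxx !orbT.
  by case/esym/orP=> /eqP // -> /orP[] /eqP.
apply: eq_card => E; rewrite !inE; apply/andP/imsetP => [[]|[y]].
  case/existsP=> y /existsP[z /andP[yz /eqP->]]; rewrite !inE.
  case/orP=> /eqP->; [exists z | exists y]; rewrite ?inE //.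
    by rewrite adj_sym.
  by rewrite setUC.
rewrite inE => xy ->; rewrite !inE eqxx; split=> //.
by apply/existsP; exists x; apply/existsP; exists y; rewrite xy eqxx.
Qed.

(** Two common neighbours of [x] and [y] would close a cycle of length 4. *)
Lemma codegree_le1 x y : C4_free G -> x != y -> (codegree x y <= 1)%N.
Proof.
move=> noC4 neq_xy; apply/card_le1_eqP => a b; rewrite !inE.
move=> /andP[xa ay] /andP[xb yb]; apply/eqP; apply: contraT.
rewrite eq_sym => neq_ab.
case: (noC4 [tuple x; a; y; b]); rewrite /ucycle /= xa ay [adj y b]adj_sym yb.
rewrite [adj b x]adj_sym xb /= !inE !negb_or neq_xy neq_ab /=.
have neq_adj (u v : G) : adj u v -> u != v.
  by apply: contraTneq => ->; rewrite adj_irrefl.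
by rewrite (neq_adj x a) // (neq_adj x b) // (neq_adj a y) // (neq_adj y b) //
  adj_sym.
Qed.

(** The left-hand sum counts the closed walks of length 4 at [x].  Off the
term [y = x] the codegrees are 0 or 1, so squaring does not change them and the
sum falls back to the count of walks of length 2. *)
Lemma sum_codegree_sqr x : C4_free G ->
  (\sum_y codegree x y ^ 2 + degree x =
   degree x ^ 2 + \sum_(y | adj x y) degree y)%N.
Proof.
move=> noC4; rewrite -sum_codegree (bigD1 x) //= [in RHS](bigD1 x) //= codegreexx.
rewrite (eq_bigr (codegree x)); first by lia.
by move=> y; rewrite eq_sym => /(codegree_le1 noC4); case: codegree => [|[]].
Qed.

(** * The adjacency matrix *)

Lemma sum_enum_val (f : G -> nat) :
  (\sum_x f x)%:R = \sum_(i < #|G|) (f (enum_val i))%:R :> algC.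
Proof.
rewrite natr_sum (reindex (fun i : 'I_#|G| => enum_val i)) //.
exact/onW_bij/enum_val_bij.
Qed.

Lemma adj_mx_sqr i j :
  (adj_mx G *m adj_mx G) i j = (codegree (enum_val i) (enum_val j))%:R.
Proof.
rewrite mxE codegree_sum sum_enum_val.
by apply: eq_bigr => k _; rewrite !mxE natrM.
Qed.

Lemma adj_mx_pow4_diag i (A := adj_mx G) :
  (A *m A *m (A *m A)) i i = (\sum_y codegree (enum_val i) y ^ 2)%:R.
Proof.
rewrite mxE sum_enum_val.
apply: eq_bigr => k _; rewrite !adj_mx_sqr -natrM mulnE.
congr (_ * _)%:R; apply: eq_card => z.
by rewrite !inE adj_sym andbC adj_sym.
Qed.

Lemma mxtrace_enum (A : 'M[algC]_#|G|) (f : G -> nat) :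
  (forall i, A i i = (f (enum_val i))%:R) -> \tr A = (\sum_x f x)%:R.
Proof.
by move=> Af; rewrite sum_enum_val; apply: eq_bigr => i _.
Qed.

Lemma adj_mx_hermitian : adj_mx G \is hermsymmx.
Proof.
apply: realsym_hermsym.
  apply/is_hermitianmxP; rewrite scale1r; apply/matrixP => i j.
  by rewrite !mxE adj_sym.
by apply/mxOverP => i j; rewrite mxE realn.
Qed.

End Walks.

(** * Eigenvalues of a hermitian matrix *)

(** The difference of the two sides is [y * (y + 4) * (y - 2) ^+ 2]: the quartic
is tangent to the line at [y = 2], the modulus that all nonzero eigenvalues
share in the extremal case of the energy bound. *)
Lemma quartic_le_linear (R : numDomainType) (y : R) : 0 <= y ->
  12 * y ^+ 2 - y ^+ 4 <= 16 * y ?= iff (y ^+ 4 == 4 * y ^+ 2).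
Proof.
move=> y0.
have E : 16 * y - (12 * y ^+ 2 - y ^+ 4) = y * (y + 4) * (y - 2) ^+ 2 by ring.
have E' : y ^+ 4 - 4 * y ^+ 2 = y ^+ 2 * (y + 2) * (y - 2) by ring.
have y_neq c : y + c.+1%:R == 0 = false by rewrite gt_eqF // ltr_wpDl.
split.
  rewrite -subr_ge0 E mulr_ge0 ?real_exprn_even_ge0 //.
    by rewrite mulr_ge0 ?addr_ge0.
  by rewrite rpredB ?ger0_real.
rewrite eq_sym -subr_eq0 E -[RHS]subr_eq0 E' !mulf_eq0 !y_neq.
by rewrite !orbF !orbb.
Qed.

Lemma quartic_le_norm (x : algC) : x \is Num.real ->
  12 * x ^+ 2 - x ^+ 4 <= 16 * `|x| ?= iff (x ^+ 4 == 4 * x ^+ 2).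
Proof.
move=> xR; rewrite (exprM x 2 2) -(real_normK xR) -exprM.
exact: quartic_le_linear.
Qed.

Section Hermitian.
Variables (n : nat) (A : 'M[algC]_n).
Hypothesis hermA : A \is hermsymmx.
Let d := spectral_diag A.
Let P := spectralmx A.

Lemma hermitian_diag : A = invmx P *m diag_mx d *m P.
Proof. exact/orthomx_spectralP/hermitian_normalmx. Qed.

Lemma diag_mx_mul (u v : 'rV[algC]_n) :
  invmx P *m diag_mx u *m P *m (invmx P *m diag_mx v *m P) =
  invmx P *m diag_mx (\row_i (u 0 i * v 0 i)) *m P.
Proof.
rewrite !mulmxA mulmxK ?spectral_unit // -[_ *m diag_mx u *m _]mulmxA.
by rewrite mulmx_diag.
Qed.

(** [eigenvalues A] comes from an arbitrary splitting of the characteristic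
polynomial; unique factorization identifies it with the diagonal of a unitary
diagonalization, up to order. *)
Lemma eigenvalues_hermitian :
  perm_eq (eigenvalues A) [seq d 0 i | i <- index_enum 'I_n].
Proof.
apply: prod_XsubC_eq; rewrite -char_poly_eigenvalues big_map.
transitivity (char_poly (diag_mx d)); last first.
  rewrite char_poly_trig ?diag_mx_is_trig //.
  by apply: eq_bigr => i _; rewrite mxE eqxx.
have Pu : map_mx polyC P \in unitmx by rewrite map_unitmx spectral_unit.
have detP : \det (map_mx polyC P) != 0.
  by move: Pu; rewrite unitmxE; apply: contraTneq => ->; rewrite unitr0.
apply: (mulfI detP); rewrite /char_poly -det_mulmx mulrC -det_mulmx.
congr (\det _); rewrite /char_poly_mx mulmxBr mulmxBl.
rewrite -scalar_mxC; congr (_ - _); rewrite -!map_mxM; congr (map_mx _ _).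
by rewrite [in LHS]hermitian_diag !mulmxA mulmxV ?spectral_unit // mul1mx.
Qed.

(** The pointwise estimate [quartic_le_norm] summed over the spectrum.  Equality
at every eigenvalue lifts to a matrix equation since [A] is
diagonalizable. *)
Lemma norm_eigenvalues_ge :
  12 * \tr (A *m A) - \tr (A *m A *m (A *m A)) <=
    16 * \sum_(mu <- eigenvalues A) `|mu|
    ?= iff (A *m A *m (A *m A) == 4 *: (A *m A)).
Proof.
have dR i : d 0 i \is Num.real.
  exact: (mxOverP (hermitian_spectral_diag_real hermA)).
pose sq := \row_i d 0 i ^+ 2; pose qu := \row_i d 0 i ^+ 4.
have A2 : A *m A = invmx P *m diag_mx sq *m P.
  rewrite {1 2}hermitian_diag diag_mx_mul; congr (_ *m diag_mx _ *m _).
have A4 : A *m A *m (A *m A) = invmx P *m diag_mx qu *m P.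
  rewrite A2 diag_mx_mul; congr (_ *m diag_mx _ *m _).
  by apply/rowP => i; rewrite !mxE -exprD.
have tr u : \tr (invmx P *m diag_mx u *m P) = \sum_i u 0 i.
  by rewrite mxtrace_mulC mulmxA mulmxV ?spectral_unit // mul1mx mxtrace_diag.
have -> : (A *m A *m (A *m A) == 4 *: (A *m A)) =
          [forall i, d 0 i ^+ 4 == 4 * d 0 i ^+ 2].
  rewrite A4 A2 scalemxAl scalemxAr.
  have mulP : injective (fun u => invmx P *m diag_mx u *m P).
    move=> u v /(congr1 (fun B => P *m B *m invmx P)).
    rewrite !mulmxA !mulmxV ?spectral_unit // !mul1mx !mulmxK ?spectral_unit //.
    move=> /matrixP uv; apply/rowP => i; move: (uv i i).
    by rewrite !mxE eqxx.
  rewrite -linearZ (inj_eq mulP).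
  apply/eqP/forallP => [/rowP e i|e]; first by have:= e i; rewrite !mxE => ->.
  by apply/rowP => i; rewrite !mxE; apply/eqP.
rewrite A4 A2 !tr (perm_big _ eigenvalues_hermitian) big_map !mulr_sumr -sumrB.
rewrite (eq_bigr (fun i => 12 * d 0 i ^+ 2 - d 0 i ^+ 4)); last first.
  by move=> i _; rewrite !mxE.
by apply: leif_sum => i _; apply: quartic_le_norm.
Qed.

End Hermitian.

(** * The energy bound *)

(** On the diagonal, [A ^ 4 = 4 A ^ 2] forces the degrees of the neighbours of
[x] to sum to [degree x * (5 - degree x)].  With maximum degree 3 this excludes
degree 1, so the bound on the degree sum leaves only 2-regular graphs, where
the sum would be both 4 and 6. *)
Lemma adj_mx_pow4_neq (G : sgraph) (A := adj_mx G) :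
  (0 < #|G|)%N -> C4_free G -> (forall x : G, 0 < degree x <= 3)%N ->
  (\sum_(x : G) degree x <= 2 * #|G|)%N ->
  A *m A *m (A *m A) != 4 *: (A *m A).
Proof.
move=> /card_gt0P[x0 _] noC4 deg13 D_le; apply/negP => /eqP A4.
pose W (x : G) := (\sum_(y | adj x y) degree y)%N.
have sum_deg (x : G) : (degree x ^ 2 + W x = 5 * degree x)%N.
  rewrite -sum_codegree_sqr // -(enum_rankK x).
  move/matrixP/(_ (enum_rank x) (enum_rank x)): A4.
  rewrite adj_mx_pow4_diag mxE adj_mx_sqr codegreexx -natrM => /eqP.
  by rewrite eqr_nat => /eqP ->; rewrite -mulSnr.
have W_le (x : G) : (W x <= 3 * degree x)%N.
  rewrite mulnC /degree cardsE -sum_nat_const; apply: leq_sum => y _.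
  by case/andP: (deg13 y).
have deg_ge2 (x : G) : (2 <= degree x)%N.
  have:= sum_deg x; have:= W_le x; have:= deg13 x; nia.
have deg_eq2 (x : G) : degree x = 2.
  have : (\sum_(y : G) (degree y - 2) = 0)%N.
    by rewrite sumnB // sum_nat_const mulnC; apply/eqP; rewrite subn_eq0.
  move/eqP; rewrite sum_nat_eq0 => /forallP/(_ x) /=; have:= deg_ge2 x; lia.
have := sum_deg x0; rewrite /W (eq_bigr (fun=> 2)) // sum_nat_const.
have -> : #|[pred y | adj x0 y]| = degree x0 by rewrite /degree cardsE.
by rewrite deg_eq2.
Qed.

Theorem theorem7 (G : sgraph) (n : nat)
  (n_gt0 : (0 < n)%N)
  (order_G : #|G| = n)
  (edges_G : (n <= #|edges G|)%N)
  (no_isolated : forall x : G, ~~ isolated x)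
  (C4_free_G : C4_free G)
  (max_degree_G : (max_degree G <= 3)%N) :
  n%:R < energy G.
Proof.
have deg_le3 (x : G) : (degree x <= 3)%N.
  by apply: leq_trans max_degree_G; exact: leq_bigmax.
have deg_gt0 (x : G) : (0 < degree x)%N by rewrite lt0n; exact: no_isolated.
have enum_sum (c : nat) : (\sum_(x : G) c = c * n)%N.
  by rewrite sum_nat_const order_G mulnC.
pose D := (\sum_(x : G) degree x)%N.
pose D2 := (\sum_(x : G) degree x ^ 2)%N.
pose W (x : G) := (\sum_(y | adj x y) degree y)%N.
pose Q := (\sum_(x : G) \sum_(y : G) codegree x y ^ 2)%N.
have D_ge : (2 * n <= D)%N by rewrite /D -handshake leq_mul2l edges_G orbT.
have D2_le : (D2 + 3 * n <= 4 * D)%N.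
  rewrite -enum_sum /D2 /D big_distrr -big_split leq_sum // => x _.
  (* [degree x ^ 2 + 3 <= 4 * degree x], true from degree 1 to degree 3 *)
  by have:= deg_gt0 x; have:= deg_le3 x; case: (degree x) => [|[|[|[]]]].
have QE : (Q + D = 2 * D2)%N.
  rewrite -big_split /= (eq_bigr (fun x : G => degree x ^ 2 + W x)%N).
    by rewrite big_split /= sum_degree_neighbours -/D2; lia.
  by move=> x _; rewrite sum_codegree_sqr.
set A := adj_mx G.
have A2 i : (A *m A) i i = (degree (enum_val i))%:R.
  by rewrite adj_mx_sqr codegreexx.
have A4_diag i : (A *m A *m (A *m A)) i i =
    (\sum_y codegree (enum_val i) y ^ 2)%:R.
  exact: adj_mx_pow4_diag.
have [le_trE eq_trE] := norm_eigenvalues_ge (adj_mx_hermitian G).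
rewrite -/(energy G) -/A in le_trE eq_trE.
have trE : 12 * \tr (A *m A) - \tr (A *m A *m (A *m A)) = 12 * D%:R - Q%:R.
  rewrite (mxtrace_enum A2).
  by rewrite (mxtrace_enum (f := fun x => \sum_y codegree x y ^ 2)%N A4_diag).
rewrite trE in le_trE eq_trE.
(* [12 * D - Q = 13 * D - 2 * D2 >= 5 * D + 6 * n] and [D >= 2 * n] *)
have le_n : 16 * n%:R <= 12 * D%:R - Q%:R :> algC.
  have -> : 12 * D%:R - Q%:R = (12 * D - Q)%:R :> algC.
    by rewrite -natrM natrB //; lia.
  by rewrite -natrM ler_nat; lia.
rewrite -(ltr_pM2l (x := 16)) // lt_neqAle (le_trans le_n le_trE) andbT.
apply/eqP => eq_n.
have eq1 : 16 * n%:R = 12 * D%:R - Q%:R :> algC.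
  by apply/eqP; rewrite eq_le le_n /= eq_n.
have D_le : (D <= 2 * n)%N.
  have : (16 * n + Q)%:R = (12 * D)%:R :> algC.
    by rewrite natrD !natrM eq1 subrK.
  by move/eqP; rewrite eqr_nat => /eqP; lia.
move: eq_trE; rewrite -eq1 eq_n eqxx => /esym; apply/negP/adj_mx_pow4_neq => //.
- by rewrite order_G.
- by move=> x; rewrite deg_gt0 deg_le3.
- by rewrite order_G.
Qed.
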